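(* For fixed demands and parameters as described in the context, and a given $\alpha\in(0,1)$, let $\beta^{\mathrm{UE}}$ be the user (Wardrop) equilibrium. Then: 1. If $\displaystyle (1-\alpha)x^{pv}<\omega\alpha\left(\frac{x^{rs}}{o^p}+f_b\right)$, then $\beta^{\mathrm{UE}}<1$. 2. If $\displaystyle (1-\alpha)(x^{pv}+x^{rs})<\omega\alpha f_b$, then $\beta^{\mathrm{UE}}=0$. Moreover, for fixed demands and parameters, there exists $\underline{\alpha}>0$ such that $\beta^{\mathrm{UE}}=1$ for all $\alpha\in(0,1)$ with $\alpha<\underline{\alpha}$.
   Context: Parameters: $t_f>0$, $C>0$, $a>0$, $b>0$, $o^p>1$ (pool occupancy), $\Delta_p>1$ (detour factor). Demands: private vehicles $x^{pv}>0$, ride-hailing $x^{rs}>0$, and bus flow $f_b>0$. The constant $\omega=\omega(n_e)\in(0,1]$ is fixed (capacity reduction due to a fixed number $n_e\ge 0$ of empty vehicles; it does not depend on $\alpha$). The constant $k=k(f_b)$ is the value at $f_b$ of a continuously differentiable function $k:[0,\infty)\to(0,\infty)$ with $k'>0$ and $k(0)>1$; in particular $k>1$. The space split is $\alpha\in(0,1)$: a fraction $\alpha$ goes to the vehicle network and $1-\alpha$ to the bus network. Delay functions, for solo demand $x^s\ge 0$ and pool demand $x^p\ge 0$: $$t_{\mathcal V}(x^s)=t_f\left(1+a\left(\frac{x^{pv}+x^s}{\omega\alpha C}\right)^b\right),\qquad t_{\mathcal B}(x^p)=t_f\left(1+a\left(\frac{\frac{x^p}{o^p}+f_b}{(1-\alpha)C}\right)^b\right)\Delta_p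 k.$$ With $\beta\in[0,1]$ the fraction of ride-hailing users who pool, the user (Wardrop) equilibrium is the unique $$\beta^{\mathrm{UE}}\in\operatorname*{arg\,min}_{\beta\in[0,1]}\int_0^{(1-\beta)x^{rs}}t_{\mathcal V}(s)\,ds+\int_0^{\beta x^{rs}}t_{\mathcal B}(s)\,ds .$$ *)

(* Defs.v *)
From Stdlib Require Import Reals.
From Coquelicot Require Import Coquelicot.
Open Scope R_scope.

(* [Rpower u b = exp (b * ln u)] is the usual power only for [u > 0]; since
   [x_pv > 0] and [f_b > 0], the bases below are positive for all demands
   [x_s, x_p >= 0]. *)
Definition t_V (t_f C a b x_pv omega alpha : R) (x_s : R) : R :=
  t_f * (1 + a * Rpower ((x_pv + x_s) / (omega * alpha * C)) b).

Definition t_B (t_f C a b o_p Delta_p f_b k alpha : R) (x_p : R) : R :=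
  t_f * (1 + a * Rpower ((x_p / o_p + f_b) / ((1 - alpha) * C)) b)
    * Delta_p * k.

Definition potential (tV tB : R -> R) (x_rs beta : R) : R :=
  RInt tV 0 ((1 - beta) * x_rs) + RInt tB 0 (beta * x_rs).

Definition is_user_equilibrium (tV tB : R -> R) (x_rs beta : R) : Prop :=
  0 <= beta <= 1 /\
  forall beta', 0 <= beta' <= 1 ->
    potential tV tB x_rs beta <= potential tV tB x_rs beta'.

(* Continuously differentiable [k : [0,oo) -> (0,oo)] with [k' > 0] and
   [k 0 > 1].  Values of [k] on negative reals are irrelevant: [D_in] and
   [continuous_on] are relative to [0,oo), hence one-sided at [0]. *)
Definition bus_factor (k : R -> R) : Prop :=
  (forall x, 0 <= x -> 0 < k x) /\
  1 < k 0 /\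
  exists k' : R -> R,
    (forall x, 0 <= x -> D_in k k' (fun y => 0 <= y) x) /\
    continuous_on (fun y => 0 <= y) k' /\
    (forall x, 0 <= x -> 0 < k' x).

(* Main.v *)
(** The potential has derivative [x_rs * (tB (beta x_rs) - tV ((1 - beta) x_rs))],
    which is strictly increasing in [beta]; hence it is strictly convex and its
    minimizer is characterized by complementarity: pooling is no slower than riding
    solo unless [beta = 0], and no faster unless [beta = 1].  The three claims
    compare the two delays at [beta = 1] and [beta = 0]; as [alpha] tends to 0 the
    solo delay at zero demand blows up while the pool delay stays bounded. *)
Require Import Defs.
From Stdlib Require Import Reals Lra Ranalysis5.
From Coquelicot Require Import Coquelicot.
Open Scope R_scope.

(** * Endpoint bounds and splitting for integrals *)

Lemma RInt_gt_left (f : R -> R) (u v : R) :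
  u < v -> (forall x, u <= x <= v -> continuous f x) ->
  (forall x, u < x < v -> f u < f x) -> (v - u) * f u < RInt f u v.
Proof.
  intros Huv Hc Hf.
  replace ((v - u) * f u) with (RInt (fun _ => f u) u v)
    by (rewrite RInt_const; reflexivity).
  apply RInt_lt; auto.
  intros; apply continuous_const.
Qed.

Lemma RInt_lt_right (f : R -> R) (u v : R) :
  u < v -> (forall x, u <= x <= v -> continuous f x) ->
  (forall x, u < x < v -> f x < f v) -> RInt f u v < (v - u) * f v.
Proof.
  intros Huv Hc Hf.
  replace ((v - u) * f v) with (RInt (fun _ => f v) u v)
    by (rewrite RInt_const; reflexivity).
  apply RInt_lt; auto.
  intros; apply continuous_const.
Qed.

Lemma RInt_sub_left (f : R -> R) (u v : R) :
  (forall x, 0 <= x -> continuous f x) -> 0 <= u -> u <= v ->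
  RInt f 0 v = RInt f 0 u + RInt f u v.
Proof.
  intros Hc Hu Huv; symmetry.
  apply (RInt_Chasles f 0 u v); apply (ex_RInt_continuous (V := R_CompleteNormedModule));
    intros z; rewrite Rmin_left, Rmax_right by lra; intros; apply Hc; lra.
Qed.

(** * Equilibria for abstract increasing delays *)

Definition delay_function (t : R -> R) : Prop :=
  (forall x, 0 <= x -> continuous t x) /\
  (forall x y, 0 <= x -> x < y -> t x < t y).

(** These are the first-order conditions for minimizing [potential] over [[0,1]]. *)
Definition complementary (tV tB : R -> R) (X c : R) : Prop :=
  0 <= c <= 1 /\
  (c < 1 -> tV ((1 - c) * X) <= tB (c * X)) /\
  (0 < c -> tB (c * X) <= tV ((1 - c) * X)).

(** Moving from [c] to [d] adds an integral of one delay and removes an integral of the other, over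
    intervals of equal length. Strict monotonicity bounds each by that length times the delay at
    [c], and complementarity orders these two delays. No derivative of the potential is needed. *)
Lemma complementary_strict_min (tV tB : R -> R) (X c d : R) :
  0 < X -> delay_function tV -> delay_function tB ->
  complementary tV tB X c -> 0 <= d <= 1 -> d <> c ->
  potential tV tB X c < potential tV tB X d.
Proof.
  intros HX [cV mV] [cB mB] [Hc [H1 H0]] Hd Hdc; unfold potential.
  destruct (Rdichotomy _ _ Hdc) as [Hlt | Hlt].
  (* Here [0 <= d < c], which unlocks the condition [H0]; the other case has [c < d <= 1] and uses
     [H1]. *)
  - assert (Hp : 0 < (c - d) * X) by (apply Rmult_lt_0_compat; lra).
    assert (0 <= d * X) by (apply Rmult_le_pos; lra).
    assert (0 <= (1 - c) * X) by (apply Rmult_le_pos; lra).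
    rewrite (RInt_sub_left tV ((1 - c) * X) ((1 - d) * X)) by (auto; lra).
    rewrite (RInt_sub_left tB (d * X) (c * X)) by (auto; lra).
    assert (HV := RInt_gt_left tV ((1 - c) * X) ((1 - d) * X)).
    assert (HB := RInt_lt_right tB (d * X) (c * X)).
    specialize (HV ltac:(lra) ltac:(intros; apply cV; lra) ltac:(intros; apply mV; lra)).
    specialize (HB ltac:(lra) ltac:(intros; apply cB; lra) ltac:(intros; apply mB; lra)).
    assert (HM := Rmult_le_compat_l _ _ _ (Rlt_le _ _ Hp) (H0 ltac:(lra))).
    replace ((1 - d) * X - (1 - c) * X) with ((c - d) * X) in HV by ring.
    replace (c * X - d * X) with ((c - d) * X) in HB by ring.
    lra.
  - assert (Hp : 0 < (d - c) * X) by (apply Rmult_lt_0_compat; lra).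
    assert (0 <= c * X) by (apply Rmult_le_pos; lra).
    assert (0 <= (1 - d) * X) by (apply Rmult_le_pos; lra).
    rewrite (RInt_sub_left tV ((1 - d) * X) ((1 - c) * X)) by (auto; lra).
    rewrite (RInt_sub_left tB (c * X) (d * X)) by (auto; lra).
    assert (HV := RInt_lt_right tV ((1 - d) * X) ((1 - c) * X)).
    assert (HB := RInt_gt_left tB (c * X) (d * X)).
    specialize (HV ltac:(lra) ltac:(intros; apply cV; lra) ltac:(intros; apply mV; lra)).
    specialize (HB ltac:(lra) ltac:(intros; apply cB; lra) ltac:(intros; apply mB; lra)).
    assert (HM := Rmult_le_compat_l _ _ _ (Rlt_le _ _ Hp) (H1 ltac:(lra))).
    replace ((1 - c) * X - (1 - d) * X) with ((d - c) * X) in HV by ring.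
    replace (d * X - c * X) with ((d - c) * X) in HB by ring.
    lra.
Qed.

(** If neither corner qualifies, the pool delay minus the solo delay is negative at 0 and positive
    at 1, so it vanishes in between. *)
Lemma complementary_exists (tV tB : R -> R) (X : R) :
  0 < X -> delay_function tV -> delay_function tB ->
  exists c, complementary tV tB X c.
Proof.
  intros HX [cV _] [cB _].
  destruct (Rle_lt_dec (tV ((1 - 0) * X)) (tB (0 * X))) as [H0 | H0].
  { exists 0; repeat split; intros; lra. }
  destruct (Rle_lt_dec (tB (1 * X)) (tV ((1 - 1) * X))) as [H1 | H1].
  { exists 1; repeat split; intros; lra. }
  destruct (IVT_interv (fun c => tB (c * X) - tV ((1 - c) * X)) 0 1)
    as [c [Hc Hz]]; cbv beta in *; try lra.
  - intros c Hc.
    assert (0 <= c * X) by (apply Rmult_le_pos; lra).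
    assert (0 <= (1 - c) * X) by (apply Rmult_le_pos; lra).
    apply (continuity_pt_minus (comp tB (fun c => c * X)) (comp tV (fun c => (1 - c) * X)));
      apply continuity_pt_comp.
    + apply derivable_continuous_pt; reg.
    + apply continuity_pt_filterlim, cB; assumption.
    + apply derivable_continuous_pt; reg.
    + apply continuity_pt_filterlim, cV; assumption.
  - exists c; repeat split; intros; lra.
Qed.

Lemma user_equilibrium_unique (tV tB : R -> R) (X : R) :
  0 < X -> delay_function tV -> delay_function tB ->
  exists! c, is_user_equilibrium tV tB X c.
Proof.
  intros HX HV HB.
  destruct (complementary_exists tV tB X HX HV HB) as [c Hc].
  assert (Hmin := fun d => complementary_strict_min tV tB X c d HX HV HB Hc).
  destruct Hc as [Hc01 _].
  exists c; split.
  - split; [exact Hc01 |]; intros d Hd.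
    destruct (Req_dec d c) as [-> | Hdc]; [lra |].
    apply Rlt_le, Hmin; auto.
  - intros d [Hd Hmd].
    destruct (Req_dec d c) as [| Hdc]; [auto |].
    specialize (Hmin d Hd Hdc); specialize (Hmd c Hc01); lra.
Qed.

(** Some complementary point exists, and it would strictly beat any other minimizer, so it must be
    [c] itself. *)
Lemma user_equilibrium_complementary (tV tB : R -> R) (X c : R) :
  0 < X -> delay_function tV -> delay_function tB ->
  is_user_equilibrium tV tB X c -> complementary tV tB X c.
Proof.
  intros HX HV HB [Hc Hmc].
  destruct (complementary_exists tV tB X HX HV HB) as [d Hd].
  destruct (Req_dec c d) as [-> | Hcd]; [exact Hd |].
  assert (Hlt := complementary_strict_min tV tB X d c HX HV HB Hd Hc Hcd).
  specialize (Hmc d (proj1 Hd)); lra.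
Qed.

(** * Corner criteria from delays at extreme demands *)

Lemma complementary_lt_1 (tV tB : R -> R) (X c : R) :
  complementary tV tB X c -> tV 0 < tB X -> c < 1.
Proof.
  intros [Hc [_ H0]] Hlt.
  destruct (Req_dec c 1) as [-> | ]; [| lra].
  specialize (H0 ltac:(lra)).
  rewrite Rmult_1_l in H0; replace ((1 - 1) * X) with 0 in H0 by ring; lra.
Qed.

(** For [c < 1], monotonicity and complementarity would chain to [tV 0 < tV ((1 - c) * X) <= tB (c *
    X) < tB X]. *)
Lemma complementary_eq_1 (tV tB : R -> R) (X c : R) :
  0 < X -> delay_function tV -> delay_function tB ->
  complementary tV tB X c -> tB X < tV 0 -> c = 1.
Proof.
  intros HX [_ mV] [_ mB] [Hc [H1 _]] Hlt.
  destruct (Req_dec c 1) as [| Hne]; [assumption |].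
  specialize (H1 ltac:(lra)).
  assert (0 < (1 - c) * X) by (apply Rmult_lt_0_compat; lra).
  assert (0 <= c * X) by (apply Rmult_le_pos; lra).
  assert (tV 0 < tV ((1 - c) * X)) by (apply mV; lra).
  assert (tB (c * X) < tB X) by (apply mB; lra).
  lra.
Qed.

Lemma complementary_eq_0 (tV tB : R -> R) (X c : R) :
  0 < X -> delay_function tV -> delay_function tB ->
  complementary tV tB X c -> tV X < tB 0 -> c = 0.
Proof.
  intros HX [_ mV] [_ mB] [Hc [_ H0]] Hlt.
  destruct (Req_dec c 0) as [| Hne]; [assumption |].
  specialize (H0 ltac:(lra)).
  assert (0 < c * X) by (apply Rmult_lt_0_compat; lra).
  assert (0 <= (1 - c) * X) by (apply Rmult_le_pos; lra).
  assert (tV ((1 - c) * X) < tV X) by (apply mV; lra).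
  assert (tB 0 < tB (c * X)) by (apply mB; lra).
  lra.
Qed.

Lemma bus_factor_gt_1 (k : R -> R) (x : R) :
  bus_factor k -> 0 < x -> 1 < k x.
Proof.
  intros [_ [Hk0 [k' [Hd [_ Hpos]]]]] Hx.
  (* [k] is arbitrary on negative reals, so the two-sided notions needed by the
     mean value theorem only hold for its constant extension to the left. *)
  set (f := fun y => k (Rmax 0 y)).
  assert (Hf : forall y, 0 <= y -> f y = k y)
    by (intros; unfold f; rewrite Rmax_right; auto).
  destruct (MVT_gen f 0 x k') as [c [Hc Heq]];
    rewrite ?Rmin_left, ?Rmax_right in * by lra.
  - intros y Hy; apply is_derive_Reals; intros eps Heps.
    destruct (Hd y ltac:(lra) eps Heps) as [delta [Hdelta Hlim]].
    (* Capping the radius by [y] keeps [y + h] positive, where [f] agrees with [k]. *)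
    exists (mkposreal (Rmin delta y) ltac:(apply Rmin_pos; lra)); simpl.
    intros h Hh Hlt.
    assert (Hl := Rmin_l delta y); assert (Hr := Rmin_r delta y).
    assert (Hm := Rabs_maj2 h).
    rewrite !Hf by lra.
    specialize (Hlim (y + h)); simpl in Hlim; unfold Rdist, D_x in Hlim.
    replace (y + h - y) with h in Hlim by ring.
    apply Hlim; repeat split; lra.
  - intros y Hy eps Heps.
    destruct (cont_deriv _ _ _ _ (Hd y ltac:(lra)) eps Heps) as [delta [Hdelta Hlim]].
    exists delta; split; [exact Hdelta |].
    intros z [_ Hz]; simpl in *; unfold Rdist, D_x in *.
    rewrite (Hf y) by lra; unfold f.
    (* The limit in [Hlim] excludes the point [y] itself, hence the case split. Otherwise clamping
       [z] at 0 does not increase its distance to [y >= 0]. *)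
    destruct (Req_dec y (Rmax 0 z)) as [<- | Hne].
    + unfold Rminus; rewrite Rplus_opp_r, Rabs_R0; exact Heps.
    + apply Hlim; repeat split; auto using Rmax_l.
      apply Rle_lt_trans with (2 := Hz).
      unfold Rmax; destruct (Rle_dec 0 z); split_Rabs; lra.
  - rewrite !Hf in Heq by lra.
    assert (0 < k' c * (x - 0)) by (apply Rmult_lt_0_compat; [apply Hpos |]; lra).
    lra.
Qed.

(** * Properties of the concrete delays *)

Lemma t_V_delay (t_f C a b x_pv w alpha : R) :
  0 < t_f -> 0 < C -> 0 < a -> 0 < b -> 0 < x_pv -> 0 < w -> 0 < alpha ->
  delay_function (t_V t_f C a b x_pv w alpha).
Proof.
  intros Ht HC Ha Hb Hx Hw Hal; unfold t_V.
  assert (HD : 0 < w * alpha * C) by (repeat apply Rmult_lt_0_compat; auto).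
  split.
  - intros x Hx0; apply (ex_derive_continuous (V := R_NormedModule)).
    (* The argument of [ln] is positive even at [x = 0] because [0 < x_pv], so continuity there is
       two-sided. *)
    unfold Rpower; auto_derive; apply Rdiv_lt_0_compat; lra.
  - intros x y Hx0 Hxy.
    apply Rmult_lt_compat_l, Rplus_lt_compat_l, Rmult_lt_compat_l; auto.
    apply Rlt_Rpower_l; [auto | split; [apply Rdiv_lt_0_compat; lra |]].
    apply Rmult_lt_compat_r; [apply Rinv_0_lt_compat |]; lra.
Qed.

Lemma t_B_delay (t_f C a b o_p Delta_p f_b k alpha : R) :
  0 < t_f -> 0 < C -> 0 < a -> 0 < b -> 0 < o_p -> 0 < Delta_p -> 0 < f_b ->
  0 < k -> alpha < 1 ->
  delay_function (t_B t_f C a b o_p Delta_p f_b k alpha).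
Proof.
  intros Ht HC Ha Hb Ho HDe Hf Hk Hal; unfold t_B.
  assert (HD : 0 < (1 - alpha) * C) by (apply Rmult_lt_0_compat; lra).
  assert (Hpos : forall x, 0 <= x -> 0 < x / o_p + f_b).
  { intros x Hx; assert (0 <= x / o_p) by (apply Rdiv_le_0_compat; auto); lra. }
  split.
  - intros x Hx0; apply (ex_derive_continuous (V := R_NormedModule)).
    unfold Rpower; auto_derive; apply Rdiv_lt_0_compat; [apply Hpos |]; assumption.
  - intros x y Hx0 Hxy.
    do 2 (apply Rmult_lt_compat_r; [assumption |]).
    apply Rmult_lt_compat_l, Rplus_lt_compat_l, Rmult_lt_compat_l; auto.
    apply Rlt_Rpower_l; [auto | split; [apply Rdiv_lt_0_compat; auto |]].
    apply Rmult_lt_compat_r; [apply Rinv_0_lt_compat; auto |].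
    apply Rplus_lt_compat_r, Rmult_lt_compat_r; [apply Rinv_0_lt_compat |]; auto.
Qed.

(** The last hypothesis is the cross-multiplied comparison of the two load-to-capacity ratios, and
    the factors [Delta_p] and [k] only lengthen the pool delay. Both thresholds of the theorem are
    instances: [(s, p)] is [(0, x_rs)] or [(x_rs, 0)]. *)
Lemma t_V_lt_t_B (t_f C a b o_p Delta_p x_pv f_b w k alpha s p : R) :
  0 < t_f -> 0 < C -> 0 < a -> 0 < b -> 1 < Delta_p -> 1 < k -> 0 < w ->
  0 < alpha < 1 -> 0 < x_pv + s ->
  (1 - alpha) * (x_pv + s) < w * alpha * (p / o_p + f_b) ->
  t_V t_f C a b x_pv w alpha s < t_B t_f C a b o_p Delta_p f_b k alpha p.
Proof.
  intros Ht HC Ha Hb HDe Hk Hw Hal Hs Hlt; unfold t_V, t_B.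
  set (q := p / o_p + f_b) in *.
  set (U := (x_pv + s) / (w * alpha * C)).
  set (V := q / ((1 - alpha) * C)).
  assert (Hwa : 0 < w * alpha) by (apply Rmult_lt_0_compat; lra).
  assert (HU : 0 < U) by (apply Rdiv_lt_0_compat; auto; apply Rmult_lt_0_compat; lra).
  assert (HUV : U < V).
  { apply Rminus_lt_0.
    replace (V - U) with
      ((w * alpha * q - (1 - alpha) * (x_pv + s))
         / (w * alpha * ((1 - alpha) * C)))
      by (unfold U, V; field; lra).
    apply Rdiv_lt_0_compat; [lra |].
    repeat apply Rmult_lt_0_compat; lra. }
  assert (HP := Rlt_Rpower_l U V b Hb (conj HU HUV)).
  assert (HP0 : 0 < Rpower U b) by apply exp_pos.
  apply (Rmult_lt_compat_l a) in HP; [| assumption].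
  assert (0 < a * Rpower U b) by (apply Rmult_lt_0_compat; auto).
  apply Rlt_trans with (t_f * (1 + a * Rpower V b)).
  - apply Rmult_lt_compat_l; lra.
  - rewrite Rmult_assoc.
    rewrite <- (Rmult_1_r (t_f * (1 + a * Rpower V b))) at 1.
    apply Rmult_lt_compat_l; [apply Rmult_lt_0_compat; lra |].
    rewrite <- (Rmult_1_r 1); apply Rmult_gt_0_lt_compat; lra.
Qed.

Lemma t_V_0_large (t_f C a b x_pv w M : R) :
  0 < t_f -> 0 < C -> 0 < a -> 0 < b -> 0 < x_pv -> 0 < w -> 0 < M ->
  exists e, 0 < e /\
    forall alpha, 0 < alpha < e -> M < t_V t_f C a b x_pv w alpha 0.
Proof.
  intros Ht HC Ha Hb Hx Hw HM.
  (* [Q] is the load ratio at which the congestion term [t_f * a * Rpower Q b] equals [M]; the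
     witness below is the [alpha] at which the ratio for [x_pv] alone equals [Q]. *)
  set (Q := Rpower (M / (t_f * a)) (/ b)).
  assert (HQ : 0 < Q) by apply exp_pos.
  assert (HwC : 0 < w * C) by (apply Rmult_lt_0_compat; auto).
  assert (Hta : 0 < t_f * a) by (apply Rmult_lt_0_compat; auto).
  exists (x_pv / (w * C * Q)); split.
  { apply Rdiv_lt_0_compat; auto; apply Rmult_lt_0_compat; auto. }
  intros alpha [Hal Hlt]; unfold t_V; rewrite Rplus_0_r.
  assert (HQl : Q < x_pv / (w * alpha * C)).
  { apply Rlt_div_r; [repeat apply Rmult_lt_0_compat; auto |].
    apply Rlt_div_r in Hlt; [| apply Rmult_lt_0_compat; auto].
    lra. }
  apply (conj HQ), (Rlt_Rpower_l _ _ b Hb) in HQl.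
  unfold Q in HQl at 1; rewrite Rpower_mult, Rinv_l, Rpower_1 in HQl;
    [| apply Rdiv_lt_0_compat; auto | lra].
  apply (Rmult_lt_compat_l (t_f * a)) in HQl; [| assumption].
  replace (t_f * a * (M / (t_f * a))) with M in HQl by (field; lra).
  lra.
Qed.

Theorem proposition5
  (t_f C a b o_p Delta_p x_pv x_rs f_b n_e : R) (omega k : R -> R)
  (ht_f : 0 < t_f) (hC : 0 < C) (ha : 0 < a) (hb : 0 < b)
  (ho_p : 1 < o_p) (hDelta_p : 1 < Delta_p)
  (hx_pv : 0 < x_pv) (hx_rs : 0 < x_rs) (hf_b : 0 < f_b)
  (hn_e : 0 <= n_e) (homega : 0 < omega n_e <= 1)
  (hk : bus_factor k) :
  let w := omega n_e in
  let UE (alpha beta : R) : Prop :=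
    is_user_equilibrium
      (t_V t_f C a b x_pv w alpha)
      (t_B t_f C a b o_p Delta_p f_b (k f_b) alpha)
      x_rs beta in
  (forall alpha, 0 < alpha < 1 -> exists! beta, UE alpha beta) /\
  (forall alpha beta, 0 < alpha < 1 -> UE alpha beta ->
     ((1 - alpha) * x_pv < w * alpha * (x_rs / o_p + f_b) -> beta < 1) /\
     ((1 - alpha) * (x_pv + x_rs) < w * alpha * f_b -> beta = 0)) /\
  (exists alpha_low, 0 < alpha_low /\
     forall alpha beta, 0 < alpha < 1 -> alpha < alpha_low ->
       UE alpha beta -> beta = 1).
Proof.
  intros w UE.
  assert (Hk := bus_factor_gt_1 k f_b hk hf_b).
  assert (HV : forall alpha, 0 < alpha < 1 ->
    delay_function (t_V t_f C a b x_pv w alpha))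
    by (intros; apply t_V_delay; unfold w; lra).
  assert (HB : forall alpha, 0 < alpha < 1 ->
    delay_function (t_B t_f C a b o_p Delta_p f_b (k f_b) alpha))
    by (intros; apply t_B_delay; lra).
  assert (HUE : forall alpha beta, 0 < alpha < 1 -> UE alpha beta ->
    complementary (t_V t_f C a b x_pv w alpha)
      (t_B t_f C a b o_p Delta_p f_b (k f_b) alpha) x_rs beta)
    by (intros; apply user_equilibrium_complementary; auto).
  split; [| split].
  - intros alpha Hal; apply user_equilibrium_unique; auto.
  - intros alpha beta Hal Hbeta; split; intros Hlt.
    + eapply complementary_lt_1; [apply HUE; eauto |].
      apply t_V_lt_t_B; rewrite ?Rplus_0_r; auto; apply homega.
    + eapply complementary_eq_0; [| | | apply HUE; eauto |]; auto.
      apply t_V_lt_t_B; auto; [apply homega | lra |].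
      unfold Rdiv; rewrite Rmult_0_l, Rplus_0_l; auto.
  - (* For [alpha < 1/2], the pool delay at full demand is below its value at [1/2]. *)
    set (M := t_B t_f C a b o_p Delta_p f_b (k f_b) (1 / 2) x_rs).
    assert (Hq : 0 < x_rs / o_p + f_b).
    { assert (0 < x_rs / o_p) by (apply Rdiv_lt_0_compat; lra); lra. }
    assert (HM : 0 < M).
    { unfold M, t_B.
      assert (0 < a * Rpower ((x_rs / o_p + f_b) / ((1 - 1 / 2) * C)) b)
        by (apply Rmult_lt_0_compat; [assumption | apply exp_pos]).
      repeat apply Rmult_lt_0_compat; lra. }
    destruct (t_V_0_large t_f C a b x_pv w M) as [e [He Hlarge]];
      auto; [apply homega |].
    (* The bound [e] pushes the solo delay above [M], while [1 / 2] keeps the pool delay at most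
       [M]. *)
    exists (Rmin e (1 / 2)); split; [apply Rmin_pos; lra |].
    intros alpha beta Hal Hlow Hbeta.
    assert (Hl := Rmin_l e (1 / 2)); assert (Hr := Rmin_r e (1 / 2)).
    eapply complementary_eq_1; [| | | apply HUE; eauto |]; auto.
    apply Rle_lt_trans with M; [| apply Hlarge; lra].
    unfold M, t_B.
    do 2 (apply Rmult_le_compat_r; [lra |]).
    apply Rmult_le_compat_l, Rplus_le_compat_l, Rmult_le_compat_l; try lra.
    apply Rle_Rpower_l; [lra |].
    assert (0 < (1 - 1 / 2) * C) by (apply Rmult_lt_0_compat; lra).
    assert ((1 - 1 / 2) * C < (1 - alpha) * C) by (apply Rmult_lt_compat_r; lra).
    split; [apply Rdiv_lt_0_compat; lra |].
    apply Rmult_le_compat_l; [lra |].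
    apply Rinv_le_contravar; lra.
Qed.
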